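(* Let $m$ be a positive integer, let $\|\cdot\|$ be a norm on $\mathbb{R}^m$, and suppose that the index set $T$ is a bounded subset of $\mathbb{R}^m$. Let $T_c\subseteq\mathbb{R}^m$ be an open set that includes the convex hull of $T$, and let $f_{T_c}\colon\mathbb{R}\times T_c\to\mathbb{R}$ be a Borel measurable map with $f_t=f_{T_c}(\cdot,t)$ for every $t\in T$. Suppose that $f_{T_c}$ is differentiable with respect to its second argument $t$ on all of $T_c$. If there is some Borel measurable map $F\colon\mathbb{R}\to\mathbb{R}$ such that $$\|\nabla_t f_{T_c}(x,t)\|\leqslant F(x)\quad\text{for all }x\in\mathbb{R}\text{ and }t\in T_c,$$ with $\mathrm{E}^P(|F|)<+\infty$, then $\hat{\underline{\mathrm{E}}}_n(f)$ is a strongly consistent estimator of $\underline{\mathrm{E}}^{\mathscr{P}}(f)$.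
   Context: Setting. $\mathscr{B}$ is the Borel $\sigma$-field on $\mathbb{R}$. $T$ is a non-empty index set, $\mathscr{P}=\{P_t : t\in T\}$ is a set of probability measures on $(\mathbb{R},\mathscr{B})$, and $P$ is a probability measure on $(\mathbb{R},\mathscr{B})$, not necessarily in $\mathscr{P}$. For a probability measure $Q$, $\mathrm{E}^Q(h)=\int h\,\mathrm{d}Q$. The map $f\colon\mathbb{R}\to\mathbb{R}$ is Borel measurable with $\sup_{t\in T}\mathrm{E}^{P_t}(|f|)<+\infty$, and $\underline{\mathrm{E}}^{\mathscr{P}}(f):=\inf_{t\in T}\mathrm{E}^{P_t}(f)$. For each $t\in T$, $f_t\colon\mathbb{R}\to\mathbb{R}$ is a Borel measurable map with $\mathrm{E}^P(f_t)=\mathrm{E}^{P_t}(f)$ and $\mathrm{E}^P(|f_t|)=\mathrm{E}^{P_t}(|f|)$ (so each $f_t$ is $P$-integrable). The symbol $\nabla_t$ denotes the gradient $\big(\frac{\partial}{\partial t_1},\dots,\frac{\partial}{\partial t_m}\big)$ with respect to $t=(t_1,\dots,t_m)\in\mathbb{R}^m$. Sampling. $(\mathbb{R}^\infty,\mathscr{B}^\infty,P^\infty)$ is the countably infinite product of copies of $(\mathbb{R},\mathscr{B},P)$ and $X_k\colon\mathbb{R}^\infty\to\mathbb{R}$ is the $k$-th coordinate projection. The estimator is the (not necessarily measurable) extended real-valued map $\hat{\underline{\mathrm{E}}}_n(f):=\inf_{t\in T}\frac1n\sum_{k=1}^n f_t(X_k)$ on $\mathbb{R}^\infty$. Strong consistency.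 For any map $h\colon\mathbb{R}^\infty\to\overline{\mathbb{R}}:=\mathbb{R}\cup\{-\infty,+\infty\}$, $h^*$ denotes a minimal measurable cover: a measurable map $h^*\colon\mathbb{R}^\infty\to\overline{\mathbb{R}}$ with $h^*\geqslant h$ and such that every measurable $g\colon\mathbb{R}^\infty\to\overline{\mathbb{R}}$ with $g\geqslant h$ satisfies $g\geqslant h^*$ $P^\infty$-almost surely; it always exists and is unique up to $P^\infty$-null sets. The estimator is strongly consistent if $\big|\hat{\underline{\mathrm{E}}}_n(f)-\underline{\mathrm{E}}^{\mathscr{P}}(f)\big|^*\to0$ $P^\infty$-almost surely as $n\to+\infty$, where $|h|^*$ is the minimal measurable cover of $|h|$. *)

(* Defs.v *)
From HB Require Import structures.
From mathcomp Require Import all_boot all_order all_algebra.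
From mathcomp Require Import all_classical all_reals all_analysis measurable_realfun.

Set Implicit Arguments.
Unset Strict Implicit.
Unset Printing Implicit Defensive.

Import Order.TTheory GRing.Theory Num.Theory.
Import numFieldNormedType.Exports.

Local Open Scope classical_set_scope.
Local Open Scope ring_scope.

(* [R : realType] is the real line, equipped by the library
   with its Borel sigma-algebra. *)

Section sampling.
Context (R : realType).

(* Coordinates are numbered from 0, so [proj k] is the informal X_(k+1). *)
Definition proj (k : nat) (w : nat -> R) : R := w k.

Definition cylinders : set (set (nat -> R)) :=
  \bigcup_k preimage_set_system [set: nat -> R] (proj k) (@measurable _ R).

Definition sample_space := g_sigma_algebraType cylinders.

(* [Q] is the countably infinite product of copies of [P]: the (unique)
   probability measure on the sigma-algebra generated by the coordinate
   projections that gives finite-dimensional rectangles their product mass. *)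
Definition is_infinite_product (P : probability R R)
    (Q : probability sample_space R) : Prop :=
  forall (n : nat) (A : nat -> set R),
    (forall k, measurable (A k)) ->
    Q [set w | forall k, (k < n)%N -> A k (proj k w)]
    = (\prod_(k < n) P (A k))%E.

(* The infimum is taken in the extended reals. The value at n = 0 is a junk
   one, irrelevant to limits. *)
Definition estimator (I : Type) (T : set I) (ft : I -> R -> R) (n : nat)
    (w : sample_space) : \bar R :=
  ereal_inf [set (n%:R^-1 * \sum_(k < n) ft t (proj k w))%:E | t in T].

Definition lower_expectation (I : Type) (T : set I)
    (Pt : I -> probability R R) (f : R -> R) : \bar R :=
  ereal_inf [set 'E_(Pt t)[f] | t in T]%E.

End sampling.

Section minimal_cover.
Context d (W : measurableType d) (R : realType) (Q : probability W R).
Local Open Scope ereal_scope.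

Definition minimal_measurable_cover (h hs : W -> \bar R) : Prop :=
  [/\ measurable_fun [set: W] hs,
      forall w, h w <= hs w &
      forall g : W -> \bar R, measurable_fun [set: W] g ->
        (forall w, h w <= g w) -> {ae Q, forall w, hs w <= g w}].

(* [cov n] is a version of the minimal measurable cover of |est n - theta|.
   Minimal measurable covers exist and are unique up to null sets, so that the
   property does not depend on the chosen versions; asking for a version that
   converges rules out any vacuous reading. *)
Definition strongly_consistent (est : nat -> W -> \bar R) (theta : \bar R) :
    Prop :=
  exists2 cov : nat -> W -> \bar R,
    forall n, minimal_measurable_cover (fun w => `|est n w - theta|) (cov n) &
    {ae Q, forall w, cov n w @[n --> \oo] --> 0}.

End minimal_cover.

Section finite_dimensional.
Context (R : realType) (m : nat).

Record is_norm (N : 'rV[R]_m -> R) : Prop := IsNorm {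
  is_norm_triangle : forall u v, N (u + v) <= N u + N v ;
  is_norm_homogeneous : forall a u, N (a *: u) = `|a| * N u ;
  is_norm_separated : forall u, N u = 0 -> u = 0 }.

Definition convex_hull (A : set 'rV[R]_m) : set 'rV[R]_m :=
  smallest (@convex_set R 'rV[R]_m) A.

(* ['D_(delta_mx 0 i) h t] is the i-th partial derivative of [h] at [t]. *)
Definition gradient (h : 'rV[R]_m -> R) (t : 'rV[R]_m) : 'rV[R]_m :=
  \row_(i < m) 'D_(delta_mx 0 i) h t.

End finite_dimensional.

(* Main.v *)
Require Import Defs.
From HB Require Import structures.
From mathcomp Require Import all_boot all_order all_algebra.
From mathcomp Require Import all_classical all_reals all_analysis measurable_realfun.
From mathcomp Require Import lra.

Set Implicit Arguments.
Unset Strict Implicit.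
Unset Printing Implicit Defensive.

Import Order.TTheory GRing.Theory Num.Theory.
Import numFieldNormedType.Exports.

Local Open Scope classical_set_scope.
Local Open Scope ring_scope.

(* The strong law of large numbers is made uniform over T. Since the gradients
   are bounded by F and all norms on R^m are equivalent, t |-> f_t(x) is
   Lipschitz on T with constant G(x) = m C F(x), the segments joining points of
   T lying in the convex hull. T being totally bounded, it has finite nets of
   every mesh; the strong law at the points of a net and for G shows that
   sup_T |mean of f_t - E f_t| tends to 0 almost surely, and the distance between
   the infima is at most this supremum. The Lipschitz bound also shows that the
   infimum over T is one over a countable subset, so that the estimator is
   measurable and the covers are the distances themselves.

   The strong law is obtained from Garsia's maximal argument: with
   M_(n+1)(w) = max(0, f(w_0) + M_n(shift w)), the event A = {sup_n M_n = +oo}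
   is shift invariant and int_A (M_(n+1) - M_n o shift) >= 0, whence
   int_A f(w_0) >= 0 in the limit. As A is independent of w_0, this says
   P(A) E f >= 0; so E f < 0 forces P(A) = 0, that is, the sums of f are almost
   surely bounded above. Applying this to f - E f - e and to its negative
   analogue gives the law. *)

(** * Measure-preserving maps and the shift *)

Section transfer.
Context d1 d2 (X : measurableType d1) (Y : measurableType d2) (R : realType).
Variables (mu : {measure set X -> \bar R}) (nu : {measure set Y -> \bar R}).
Variable phi : X -> Y.
Hypothesis mphi : measurable_fun [set: X] phi.
Hypothesis phi_nu : forall B, measurable B -> mu (phi @^-1` B) = nu B.

Lemma ge0_integral_preserving (D : set Y) (g : Y -> \bar R) : measurable D ->
  measurable_fun [set: Y] g -> (forall y, 0 <= g y)%E ->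
  (\int[mu]_(x in phi @^-1` D) g (phi x) = \int[nu]_(y in D) g y)%E.
Proof.
move=> mD mg g0.
transitivity (\int[pushforward mu phi]_(y in D) g y)%E.
  by rewrite ge0_integral_pushforward//; exact: measurable_funTS.
by apply: eq_measure_integral => B mB _; rewrite -phi_nu.
Qed.

Lemma integrable_preserving (g : Y -> \bar R) :
  nu.-integrable [set: Y] g -> mu.-integrable [set: X] (g \o phi).
Proof.
move=> /integrableP[mg ig]; apply/integrableP; split.
  exact: measurableT_comp.
have /= -> // := @ge0_integral_preserving setT (fun y => `|g y|%E) measurableT.
exact: measurableT_comp.
Qed.

End transfer.

Section shift.
Context (R : realType).

Definition shift (w : sample_space R) : sample_space R := fun k => w k.+1.

Definition rectangle (n : nat) (A : nat -> set R) : set (sample_space R) :=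
  [set w | forall k, (k < n)%N -> A k (Defs.proj k w)].

(** These sets form a pi-system generating the sigma-algebra, and [is_infinite_product] prescribes
    the measure exactly on them. *)
Definition rectangles : set (set (sample_space R)) :=
  [set rectangle n A | n in [set: nat] & A in [set A | forall k, measurable (A k)]].

(* Unqualified, [proj] denotes the projections of product topologies. *)
Lemma measurable_proj k : measurable_fun [set: sample_space R] (Defs.proj k).
Proof.
move=> _ B mB; rewrite setTI; apply: sub_sigma_algebra.
by exists k => //; exists B => //; rewrite setTI.
Qed.

Lemma measurable_shift : measurable_fun [set: sample_space R] shift.
Proof.
apply: (@measurability _ _ _ (sample_space R) _ _ (@cylinders R)) => //.
move=> _ [_ [k _ [B mB <-]] <-].
rewrite !setTI; rewrite -[X in measurable X]setTI.
exact: (@measurable_proj k.+1).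
Qed.

Lemma measurable_rectangle n A :
  (forall k, measurable (A k)) -> measurable (rectangle n A).
Proof.
move=> mA.
have -> : rectangle n A = \bigcap_(k < n) (Defs.proj k @^-1` A k) by [].
apply: bigcap_measurableType => k _; rewrite -[X in measurable X]setTI.
exact: measurable_proj.
Qed.

Lemma rectanglesI : setI_closed rectangles.
Proof.
move=> _ _ [n _ [A mA <-]] [p _ [B mB <-]].
(* Both rectangles are padded with the whole line up to [maxn n p] sides. *)
pose C k := (if (k < n)%N then A k else setT) `&` (if (k < p)%N then B k else setT).
exists (maxn n p) => //; exists C.
  by move=> k; apply: measurableI; case: ifP.
apply/seteqP; split=> [w h|w [hA hB] k _]; last first.
  by split; case: ifP => // kn; [exact: hA|exact: hB].
split=> k kn; have := h k; rewrite leq_max kn ?orbT => /(_ isT)[].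
  by rewrite kn.
by rewrite [X in _ -> X -> _]/= kn.
Qed.

Lemma measurable_rectangles (B : set (sample_space R)) :
  measurable B -> <<s rectangles >> B.
Proof.
apply: smallest_sub; first exact: smallest_sigma_algebra.
move=> _ [k _ [B' mB' <-]]; apply: sub_sigma_algebra.
exists k.+1 => //; exists (fun j => if j == k then B' else setT).
  by move=> j /=; case: ifP.
rewrite setTI; apply/seteqP; split=> [w /(_ k)|w wB j _].
  by rewrite ltnSn eqxx; exact.
by case: eqP => // ->.
Qed.

End shift.

(** * Independence of the first coordinate and the shifted sequence *)

Section independence.
Context (R : realType) (P : probability R R) (Q : probability (sample_space R) R).
Hypothesis PQ : is_infinite_product P Q.

Let PCnng (C : set R) : (0 <= fine (P C))%R. Proof. exact: fine_ge0. Qed.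

(** For fixed [C] both sides are finite measures in [B], so agreement on the pi-system of rectangles
    suffices; there it is the product formula for the rectangle with [C] put in front. *)
Lemma proj0_shift_indep (C : set R) (B : set (sample_space R)) :
  measurable C -> measurable B ->
  Q (Defs.proj 0 @^-1` C `&` @shift R @^-1` B) = (P C * Q B)%E.
Proof.
move=> mC mB.
have mC' : measurable (Defs.proj 0 @^-1` C : set (sample_space R)).
  by rewrite -[X in measurable X]setTI; exact: measurable_proj.
pose m1' : {measure set (sample_space R) -> \bar R} :=
  pushforward (mrestr Q mC') (@shift R).
pose m1 := m1' (@measurable_shift R).
pose m2 : {measure set (sample_space R) -> \bar R} := mscale (NngNum (PCnng C)) Q.
have m2E A : m2 A = (P C * Q A)%E.
  by rewrite /m2 /= /mscale /= fineK// fin_num_measure.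
have m1E A : m1 A = Q (Defs.proj 0 @^-1` C `&` @shift R @^-1` A).
  by rewrite setIC.
rewrite -m1E -m2E.
apply: (g_sigma_algebra_measure_unique (@rectangles R) _ (fun=> setT)).
- by move=> _ [n _ [A mA <-]]; exact: measurable_rectangle.
- move=> _; exists 0%N => //; exists (fun=> setT) => //.
  by apply/seteqP; split.
- by apply/seteqP; split => // w _; exists 0%N.
- exact: rectanglesI.
- move=> _ [n _ [A mA <-]]; rewrite m1E m2E.
  rewrite (PQ n mA).
  pose A' k := if k is k'.+1 then A k' else C.
  have mA' k : measurable (A' k) by case: k.
  have := PQ n.+1 mA'; rewrite big_ord_recl /= => <-.
  congr (Q _); apply/seteqP; split=> [w [w0 wA] [_|k kn]|w h].
  + exact: w0.
  + exact: (wA k).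
  + by split; [exact: (h 0%N)|move=> k kn; exact: (h k.+1)].
- move=> _; rewrite m1E; apply: le_lt_trans (probability_le1 Q _) (ltry _).
  apply: measurableI => //; rewrite -[X in measurable X]setTI.
  exact: measurable_shift.
- exact: measurable_rectangles.
Qed.

Lemma shift_preserving (B : set (sample_space R)) :
  measurable B -> Q (@shift R @^-1` B) = Q B.
Proof.
move=> mB; have := proj0_shift_indep measurableT mB.
by rewrite preimage_setT setTI probability_setT mul1e.
Qed.

(* A shift-invariant event depends only on the coordinates after the first one,
   hence is independent of the first one. *)
Lemma proj0_invariant_law (A : set (sample_space R)) (mA : measurable A)
    (C : set R) :
  @shift R @^-1` A = A -> measurable C ->
  mrestr Q mA (Defs.proj 0 @^-1` C) = (P C * Q A)%E.
Proof.
by move=> iA mC; rewrite /mrestr -{1}iA; exact: proj0_shift_indep.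
Qed.

Lemma proj0_law (C : set R) : measurable C -> Q (Defs.proj 0 @^-1` C) = P C.
Proof.
move=> mC; have := proj0_shift_indep mC measurableT.
by rewrite preimage_setT setIT probability_setT mule1.
Qed.

(** The image under the first coordinate of [Q] restricted to [A] is [Q A] times [P], so this is a
    change of variables. *)
Lemma ge0_integral_proj0_invariant (A : set (sample_space R)) (g : R -> \bar R) :
  measurable A -> @shift R @^-1` A = A ->
  measurable_fun [set: R] g -> (forall x, 0 <= g x)%E ->
  (\int[Q]_(w in A) g (Defs.proj 0 w) = Q A * \int[P]_x g x)%E.
Proof.
move=> mA iA mg g0.
have QA0 : (0 <= fine (Q A))%R by exact: fine_ge0.
pose nu : {measure set R -> \bar R} := mscale (NngNum QA0) P.
have nuE C : measurable C -> mrestr Q mA (Defs.proj 0 @^-1` C) = nu C.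
  move=> mC; rewrite proj0_invariant_law// /nu /= /mscale /= fineK 1?muleC//.
  exact: fin_num_measure.
have mgp : measurable_fun [set: sample_space R] (fun w => g (Defs.proj 0 w)).
  by apply: measurableT_comp => //; exact: measurable_proj.
transitivity (\int[mrestr Q mA]_w g (Defs.proj 0 w))%E.
  have A0 : mrestr Q mA (~` A) = 0%E by rewrite /mrestr setICl measure0.
  rewrite [RHS](ge0_negligible_integral (measurableC mA) _ _ _ A0)//.
  rewrite setTD setCK; apply: eq_measure_integral => B mB BA.
  by rewrite /= /mrestr setIidl.
have /= -> := ge0_integral_preserving (@measurable_proj R 0) nuE measurableT mg g0.
rewrite ge0_integral_mscale//= fineK//.
exact: fin_num_measure.
Qed.

Lemma integral_proj0_invariant (A : set (sample_space R)) (g : R -> \bar R) :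
  measurable A -> @shift R @^-1` A = A -> P.-integrable [set: R] g ->
  (\int[Q]_(w in A) g (Defs.proj 0 w) = Q A * \int[P]_x g x)%E.
Proof.
move=> mA iA ig; have mg := measurable_int _ ig.
rewrite integralE [in RHS]integralE muleBr//; last 2 first.
- exact: fin_num_measure.
- by apply: fin_num_adde_defl; rewrite fin_numN integrable_neg_fin_num.
rewrite -!ge0_integral_proj0_invariant//; last 2 first.
- exact: measurable_funeneg.
- exact: measurable_funepos.
congr (_ - _)%E; apply: eq_integral => w _.
  by rewrite (funepos_comp g (@Defs.proj R 0)).
by rewrite (funeneg_comp g (@Defs.proj R 0)).
Qed.

End independence.

(** * The strong law of large numbers *)

Section maximal.
Context (R : realType) (P : probability R R) (Q : probability (sample_space R) R).
Hypothesis PQ : is_infinite_product P Q.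
Variable f : R -> R.
Hypothesis mf : measurable_fun [set: R] f.
Hypothesis int_f : P.-integrable [set: R] (EFin \o f).

(* The largest of the sums of [f] over the first [k <= n] coordinates of [w],
   the empty sum included; this recursion is Garsia's form of the maximum. *)
Fixpoint maxsum (n : nat) (w : sample_space R) : R :=
  if n is n'.+1 then Num.max 0 (f (w 0%N) + maxsum n' (shift w)) else 0.

Lemma maxsum_ge0 n w : 0 <= maxsum n w.
Proof. by case: n => //= n; rewrite le_max lexx. Qed.

Lemma maxsum_nondecreasing w : nondecreasing_seq (maxsum ^~ w).
Proof.
apply/nondecreasing_seqP => n; elim: n w => [|n IH] w; first exact: maxsum_ge0.
rewrite [maxsum n.+1 w]/= [maxsum n.+2 w]/= ge_max !le_max lexx/=.
by rewrite [X in _ || X]lerD2l IH orbT.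
Qed.

Lemma sum_le_maxsum n (w : sample_space R) : \sum_(k < n) f (w k) <= maxsum n w.
Proof.
elim: n w => [|n IH] w; first by rewrite big_ord0.
by rewrite big_ord_recl /= le_max lerD2l (IH (shift w)) orbT.
Qed.

(** The left side is what Garsia's argument integrates; the right side is dominated by [|f (w 0)|]
    and equals [f (w 0)] once [maxsum n (shift w)] is large. *)
Lemma maxsumS_sub n w :
  maxsum n.+1 w - maxsum n (shift w) = Num.max (f (w 0%N)) (- maxsum n (shift w)).
Proof. by rewrite /= addrC addr_maxr addr0 addrCA addNr addr0 maxC. Qed.

Lemma measurable_fun_proj0 : measurable_fun [set: sample_space R] (fun w => f (w 0%N)).
Proof. by apply: measurableT_comp => //; exact: (@measurable_proj R 0). Qed.

Lemma measurable_maxsum n : measurable_fun [set: sample_space R] (maxsum n).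
Proof.
elim: n => [|n IH]; first exact: measurable_cst.
apply: measurable_maxr; first exact: measurable_cst.
apply: measurable_funD; first exact: measurable_fun_proj0.
by apply: measurableT_comp => //; exact: measurable_shift.
Qed.

Lemma integrable_fun_proj0 :
  Q.-integrable [set: sample_space R] (fun w => (f (w 0%N))%:E).
Proof. exact: (integrable_preserving (@measurable_proj R 0) (proj0_law PQ) int_f). Qed.

Lemma integrable_maxsum n :
  Q.-integrable [set: sample_space R] (EFin \o maxsum n).
Proof.
elim: n => [|n IH]; first exact: integrable0.
apply: (@le_integrable _ _ _ Q setT measurableT _
  (fun w : sample_space R => ((f (w 0%N))%:E + (maxsum n (shift w))%:E)%E)).
- by apply/measurable_EFinP; exact: (measurable_maxsum n.+1).
- move=> w _; rewrite -EFinD !abse_EFin lee_fin /=.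
  by case: (leP 0 (_ + _)) => // _; rewrite normr0.
apply: integrableD => //; first exact: integrable_fun_proj0.
exact: (integrable_preserving (@measurable_shift R) (shift_preserving PQ) IH).
Qed.

Definition unbounded_sums : set (sample_space R) :=
  [set w | forall K : nat, exists n, K%:R < maxsum n w].

(** The first term shifts the sums by an amount fixed for each [w], which is absorbed by raising the
    threshold above [|f (w 0)| + K]. *)
Lemma unbounded_sums_shift : @shift R @^-1` unbounded_sums = unbounded_sums.
Proof.
apply/seteqP; split=> w h K.
  pose K' := Num.truncn (`|f (w 0%N)| + K%:R).
  have [n Kn] := h K'.+1; exists n.+1.
  have := ltW Kn; have := truncnS_gt (`|f (w 0%N)| + K%:R); rewrite -/K'.
  have := ler_norm (- f (w 0%N)); rewrite normrN /= => h1 h2 h3.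
  rewrite lt_max; apply/orP; right; lra.
pose K' := Num.truncn (`|f (w 0%N)| + K%:R).
have [[|n] Kn] := h K'.+1; first by move: Kn; rewrite /= ltNge ler0n.
exists n; move: Kn; rewrite /= lt_max ltNge ler0n /= => Kn.
have := truncnS_gt (`|f (w 0%N)| + K%:R); rewrite -/K'.
have := ler_norm (f (w 0%N)) => h1 h2; lra.
Qed.

Lemma measurable_unbounded_sums : measurable unbounded_sums.
Proof.
have -> : unbounded_sums = \bigcap_(K in [set: nat])
    \bigcup_(n in [set: nat]) (maxsum n @^-1` `]K%:R, +oo[).
  apply/seteqP; split=> w h K.
    by move=> _; have [n Kn] := h K; exists n => //=; rewrite in_itv/= Kn.
  by have [n _ /=] := h K I; rewrite in_itv/= andbT => Kn; exists n.
apply: bigcap_measurableType => K _; apply: bigcupT_measurable => n.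
by rewrite -[X in measurable X]setTI; exact: measurable_maxsum.
Qed.

Local Open Scope ereal_scope.

(** Dominated convergence: on the event, [h n] is eventually [f (w 0)], while each integral of [h n]
    is nonnegative because [maxsum] increases with [n] and the shift preserves both [Q] and the
    event. *)
Lemma integral_unbounded_sums_ge0 :
  0 <= \int[Q]_(w in unbounded_sums) (f (w 0%N))%:E.
Proof.
set A := unbounded_sums.
have mA : measurable A := measurable_unbounded_sums.
have mfA := integrableS measurableT mA (@subsetT _ A) integrable_fun_proj0.
pose h n (w : sample_space R) := (Num.max (f (w 0%N)) (- maxsum n (shift w)))%:E.
have mh n : measurable_fun A (h n).
  apply/measurable_EFinP/measurable_funTS/measurable_maxr.
    exact: measurable_fun_proj0.
  apply: measurableT_comp => //.
  by apply: measurableT_comp; [exact: measurable_maxsum|exact: measurable_shift].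
(* Where the maximum is not [f (w 0)], it lies between [f (w 0)] and 0. *)
have hle n w : `|h n w| <= `|(f (w 0%N))%:E|.
  rewrite /h !abse_EFin lee_fin; have M0 := maxsum_ge0 n (shift w).
  have [//|h0] := leP (- maxsum n (shift w))%R (f (w 0%N)).
  by rewrite normrN (ger0_norm M0) ltr0_norm; lra.
have hcvg : {ae Q, forall w, A w -> h ^~ w @ \oo --> (f (w 0%N))%:E}.
  apply: aeW => w Aw; apply: cvg_near_cst.
  (* By invariance [maxsum] is unbounded along [shift w] too, so [- maxsum n (shift w)] drops below
     [f (w 0)]. *)
  have : A (shift w) by rewrite -[A]unbounded_sums_shift in Aw.
  move=> /(_ (Num.truncn `|f (w 0%N)|).+1)[n Kn].
  near=> p; rewrite /h; congr EFin; apply/max_idPl.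
  have : (maxsum n (shift w) <= maxsum p (shift w))%R.
    by apply: maxsum_nondecreasing; near: p; exact: nbhs_infty_ge.
  have := truncnS_gt `|f (w 0%N)|.
  have := ler_norm (- f (w 0%N)); rewrite normrN; lra.
have [_ _ hint] := @dominated_convergence _ _ _ Q A mA h (fun w => (f (w 0%N))%:E)
   (fun w => `|(f (w 0%N))%:E|) mh (measurable_int _ mfA) hcvg (integrable_abse mfA)
   (aeW _ (fun w n _ => hle n w)).
rewrite -(cvg_lim _ hint)//.
apply: lime_ge; first by apply/cvg_ex; eexists; exact: hint.
near=> n => /=.
have iM k : Q.-integrable A (EFin \o maxsum k).
  by apply: (integrableS measurableT mA) => //; exact: integrable_maxsum.
have iMs k : Q.-integrable [set: sample_space R] (fun w => (maxsum k (shift w))%:E).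
  exact: (integrable_preserving (@measurable_shift R) (shift_preserving PQ)
    (integrable_maxsum k)).
have iMsA k : Q.-integrable A (fun w => (maxsum k (shift w))%:E).
  exact: (integrableS measurableT mA).
under eq_integral do rewrite /h -maxsumS_sub EFinB.
rewrite integralB//; last exact: iM.
have -> : \int[Q]_(w in A) (maxsum n (shift w))%:E = \int[Q]_(w in A) (maxsum n w)%:E.
  rewrite -[in LHS](unbounded_sums_shift : _ = A).
  have mM : measurable_fun [set: sample_space R] (EFin \o maxsum n).
    by apply/measurable_EFinP; exact: measurable_maxsum.
  have M0 w : 0 <= (EFin \o maxsum n) w by rewrite lee_fin maxsum_ge0.
  exact: (ge0_integral_preserving (@measurable_shift R) (shift_preserving PQ) mA mM M0).
rewrite sube_ge0; last by rewrite (integrable_fin_num mA (iM n)).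
apply: le_integral => //; [exact: iM|exact: iM|move=> w _].
by rewrite lee_fin; exact: maxsum_nondecreasing.
Unshelve. all: by end_near.
Qed.

Lemma unbounded_sums_null : \int[P]_x (f x)%:E < 0 -> Q unbounded_sums = 0.
Proof.
move=> f0.
have := integral_unbounded_sums_ge0.
rewrite (integral_proj0_invariant PQ measurable_unbounded_sums
  unbounded_sums_shift int_f).
rewrite muleC nmule_rge0// => QA.
by apply/eqP; rewrite eq_le QA measure_ge0.
Qed.

Lemma ae_sums_bounded : \int[P]_x (f x)%:E < 0 ->
  {ae Q, forall w : sample_space R, exists K : R, forall n,
    (\sum_(k < n) f (w k) <= K)%R}.
Proof.
move=> f0; exists unbounded_sums; split.
- exact: measurable_unbounded_sums.
- exact: unbounded_sums_null.
move=> w /= h; apply: contrapT => /existsNP[K hK]; apply: h.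
exists K%:R%R => n; apply: le_trans (sum_le_maxsum n w) _.
by rewrite leNgt; apply/negP => Kn; apply: hK; exists n.
Qed.

End maximal.

(** * From bounded sums to convergence of means *)

Section strong_law.
Context (R : realType) (P : probability R R) (Q : probability (sample_space R) R).
Hypothesis PQ : is_infinite_product P Q.

Definition mean (g : R -> R) (n : nat) (w : sample_space R) : R :=
  n%:R^-1 * \sum_(k < n) g (w k).

(** The function [g - E - e / 2] has negative expectation, so its sums are almost surely below some
    [K]; after division by [n], [K / n] is absorbed by the other [e / 2]. *)
Lemma ae_mean_near_le (g : R -> R) (e : R) :
  P.-integrable [set: R] (EFin \o g) -> 0 < e ->
  {ae Q, forall w, \forall n \near \oo,
    mean g n w <= fine (\int[P]_x (g x)%:E)%E + e}.
Proof.
move=> ig e0; set E := fine _.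
have intE : (\int[P]_x (g x)%:E)%E = E%:E.
  by rewrite fineK//; exact: (integrable_fin_num measurableT ig).
pose c := E + e / 2.
have ic : P.-integrable [set: R] (EFin \o cst c).
  exact: finite_measure_integrable_cst.
have igc : P.-integrable [set: R] (EFin \o (fun x => g x - c)).
  exact: (integrableB measurableT ig ic).
have mgc : measurable_fun [set: R] (fun x => g x - c).
  by apply/measurable_EFinP; exact: measurable_int igc.
have neg : (\int[P]_x (g x - c)%:E < 0)%E.
  under eq_integral do rewrite EFinB.
  have intc : (\int[P]_x (cst c x)%:E)%E = c%:E.
    by have := expectation_cst P c; rewrite unlock.
  by rewrite (integralB measurableT ig ic) intE intc -EFinB lte_fin /c; lra.
apply: filterS (ae_sums_bounded PQ mgc igc neg) => w [K hK].
near=> n.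
have n0 : 0 < n%:R :> R by rewrite ltr0n; near: n; exact: nbhs_infty_gt.
rewrite /mean mulrC ler_pdivrMr//.
have Kn : K <= e / 2 * n%:R.
  rewrite mulrC -ler_pdivrMr ?divr_gt0//.
  by near: n; exact: nbhs_infty_ger.
have := hK n; rewrite sumrB sumr_const card_ord -mulr_natr /c; nra.
Unshelve. all: by end_near.
Qed.

Lemma meanN (g : R -> R) n w : mean (fun x => - g x) n w = - mean g n w.
Proof. by rewrite /mean sumrN mulrN. Qed.

(** The one-sided estimate is applied to [g] and to [- g]; taking only the countably many errors
    [j.+1%:R^-1] leaves a single null set. *)
Lemma strong_law_of_large_numbers (g : R -> R) :
  P.-integrable [set: R] (EFin \o g) ->
  {ae Q, forall w, mean g n w @[n --> \oo] --> \int[P]_x g x}.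
Proof.
move=> ig.
have igN : P.-integrable [set: R] (EFin \o (fun x => - g x)).
  exact: integrableN ig.
have j0 (j : nat) : 0 < j.+1%:R^-1 :> R by rewrite invr_gt0.
have := ae_foralln (fun j => ae_mean_near_le igN (j0 j)).
apply: filterS2 (ae_foralln (fun j => ae_mean_near_le ig (j0 j))) => w up lo.
have intN : fine (\int[P]_x (- g x)%:E)%E = - fine (\int[P]_x (g x)%:E)%E.
  rewrite -fineN -integralN//; last exact: integrable_add_def.
apply/cvgrPdist_le => e e0.
have [j je] : exists j : nat, j.+1%:R^-1 <= e.
  by exists (Num.truncn e^-1); rewrite invf_ple// ?posrE// ltW// truncnS_gt.
near=> n.
have upn : mean g n w <= fine (\int[P]_x (g x)%:E)%E + j.+1%:R^-1.
  by near: n; exact: up.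
have lon : mean (fun x => - g x) n w <= fine (\int[P]_x (- g x)%:E)%E + j.+1%:R^-1.
  by near: n; exact: lo.
suff /le_trans/(_ je) : `|\int[P]_x g x - mean g n w| <= j.+1%:R^-1 by [].
move: upn lon; rewrite meanN intN ler_norml /Rintegral.
move: (fine _) (mean g n w) (_^-1) => E M r EM ME; apply/andP; split; lra.
Unshelve. all: by end_near.
Qed.

End strong_law.

(** * Lipschitz dependence on the parameter *)

Section norm_equivalence.
Context (R : realType) (m : nat) (N : 'rV[R]_m -> R).
Hypothesis normN : is_norm N.

Let N_triangle u v : N (u + v) <= N u + N v.
Proof. exact: is_norm_triangle. Qed.

Let NZ a u : N (a *: u) = `|a| * N u.
Proof. exact: is_norm_homogeneous. Qed.

Let N0 : N 0 = 0.
Proof. by rewrite -(scale0r (0 : 'rV[R]_m)) NZ normr0 mul0r. Qed.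

Let NN u : N (- u) = N u.
Proof. by rewrite -scaleN1r NZ normrN1 mul1r. Qed.

Lemma is_norm_ge0 u : 0 <= N u.
Proof. by have := N_triangle u (- u); rewrite subrr N0 NN; lra. Qed.

(** The library norm of a row vector is the maximum of the absolute values of its coordinates. *)
Lemma rV_coord_le (u : 'rV[R]_m) i : `|u 0 i| <= `|u|.
Proof.
rewrite [leRHS]/Num.norm /= mx_normrE.
exact: (@le_bigmax _ _ _ _ (fun ij => `|u ij.1 ij.2|) (0, i)).
Qed.

Let N_le_norm u : N u <= (\sum_(i < m) N (delta_mx 0 i)) * `|u|.
Proof.
rewrite [u in N u]row_sum_delta mulr_suml.
elim/big_ind2 : _ => [|a b c d ab cd|i _]; first by rewrite N0.
  exact: le_trans (N_triangle _ _) (lerD ab cd).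
by rewrite NZ mulrC ler_wpM2l ?is_norm_ge0// rV_coord_le.
Qed.

Let N_continuous : continuous N.
Proof.
move=> u; apply/(@cvgrPdist_le _ _ _ (nbhs u)) => e e0 /=.
pose K := \sum_(i < m) N (delta_mx 0 i) + 1.
have K0 : 0 < K by apply: ltr_wpDl => //; apply: sumr_ge0 => i _; exact: is_norm_ge0.
have eK0 : 0 < e / K by rewrite divr_gt0.
apply: filterS (nbhsx_ballx u (e / K) eK0) => v; rewrite -ball_normE /= => /ltW uv.
have h w : N w <= K * `|w|.
  by apply: le_trans (N_le_norm w) _; rewrite ler_wpM2r// /K lerDl.
have Kuv : K * `|u - v| <= e by rewrite mulrC -ler_pdivlMr.
have h1 := le_trans (h (u - v)) Kuv.
have := N_triangle (u - v) v; rewrite subrK => h2.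
have := N_triangle (v - u) u; rewrite subrK -opprB NN => h3.
by rewrite ler_norml; apply/andP; split; lra.
Qed.

(** [N] is continuous, so it has a minimum on the compact unit sphere of the maximum norm; this
    minimum is positive by separation, and homogeneity extends the bound to all vectors. *)
Lemma norm_le_is_norm : exists2 C, 0 <= C & forall u, `|u| <= C * N u.
Proof.
pose S := [set u : 'rV[R]_m | `|u| = 1].
(* If the sphere is empty, every vector is 0 and the constant 0 will do. *)
have [S0|/set0P/negP/negPn/eqP S0] := pselect (S !=set0); last first.
  exists 0 => // u; rewrite mul0r normr_le0; apply/negPn/negP => u0.
  have : S (`|u|^-1 *: u) by rewrite /S /= normrZ normfV normr_id mulVf// normr_eq0.
  by rewrite S0.
have cS : compact S.
  apply: bounded_closed_compact.
    by exists 1; split => // x x1 u /= ->; exact: ltW.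
  have -> : S = (fun u : 'rV[R]_m => `|u|) @^-1` [set x | x = 1] by [].
  apply: closed_comp; last exact: closed_eq.
  by move=> u _; exact: norm_continuous.
have [c cS1 cmin] := EVT_min_rV S0 cS (continuous_subspaceT N_continuous).
have {cS1}c1 : `|c| = 1 by rewrite inE in cS1.
have Nc : 0 < N c.
  rewrite lt_def is_norm_ge0 andbT; apply/eqP => /(is_norm_separated normN) c0.
  by move: c1; rewrite c0 normr0 => /eqP; rewrite eq_sym oner_eq0.
exists (N c)^-1; first by rewrite invr_ge0 ltW.
move=> u; have [->|u0] := eqVneq u 0; first by rewrite normr0 N0 mulr0.
have nu0 : 0 < `|u| by rewrite normr_gt0.
have := cmin (`|u|^-1 *: u); rewrite inE /S /= normrZ normfV normr_id mulVf ?gt_eqF//.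
move=> /(_ erefl); rewrite NZ normfV normr_id ler_pdivlMl// => h.
by rewrite ler_pdivlMl// mulrC.
Qed.

End norm_equivalence.

(** * Mean value inequality along segments *)

Section mean_value.
Context (R : realType) (m : nat).
Implicit Types (h : 'rV[R]_m -> R) (p s t v : 'rV[R]_m).

Lemma derive_gradient h p v : differentiable h p ->
  'D_v h p = \sum_(i < m) v 0 i * gradient h p 0 i.
Proof.
move=> dh; rewrite deriveE// {1}(row_sum_delta v) linear_sum.
by apply: eq_bigr => i _; rewrite linearZ mxE deriveE.
Qed.

(** The factor [m] comes from bounding each of the [m] terms of the scalar product by the product of
    the maximum norms. *)
Lemma normr_derive_le h p v : differentiable h p ->
  `|'D_v h p| <= m%:R * (`|v| * `|gradient h p|).
Proof.
move=> dh; rewrite derive_gradient//; apply: le_trans (ler_norm_sum _ _ _) _.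
rewrite mulr_natl -[X in _ *+ X](card_ord m) -sumr_const; apply: ler_sum => i _.
by rewrite normrM ler_pM// rV_coord_le.
Qed.

Lemma is_derive_line h s v (l : R) : differentiable h (s + l *: v) ->
  is_derive l 1 (fun x : R => h (s + x *: v)) ('D_v h (s + l *: v)).
Proof.
move=> dh; pose g : R -> 'rV[R]_m := cst s + *:%R ^~ v.
have dg : is_diff l g (0 + *:%R ^~ v) by exact: is_diffD.
rewrite -[fun x : R => _]/(h \o g) -/(g l) in dh *.
have dhg : differentiable (h \o g) l by exact: differentiable_comp.
apply: DeriveDef; first exact/derivable1_diffP.
by rewrite deriveE// diff_comp// /= diff_val deriveE//= add0r scale1r.
Qed.

Lemma mean_value_le h s t (B : R) :
  (forall l, 0 <= l <= 1 -> differentiable h (s + l *: (t - s))) ->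
  (forall l, 0 <= l <= 1 -> `|gradient h (s + l *: (t - s))| <= B) ->
  `|h t - h s| <= m%:R * B * `|t - s|.
Proof.
move=> dh hB.
have [| |l l01] := @MVT_segment R (fun x : R => h (s + x *: (t - s)))
    (fun x => 'D_(t - s) h (s + x *: (t - s))) 0 1 ler01.
- move=> x; rewrite in_itv /= => /andP[x0 x1].
  by apply: is_derive_line; apply: dh; rewrite !ltW.
- apply: derivable_within_continuous => x; rewrite in_itv /= => x01.
  by have := is_derive_line (dh x x01) => /@ex_derive.
rewrite in_itv /= in l01.
rewrite scale1r scale0r addr0 (addrC s) subrK subr0 mulr1 => ->.
apply: le_trans (normr_derive_le _ (dh _ l01)) _.
by rewrite -mulrA ler_wpM2l// mulrC ler_wpM2r// hB.
Qed.

End mean_value.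

(** * Finite nets and segments in bounded sets *)

Section bounded_sets.
Context (R : realType) (m : nat).
Implicit Types (T : set 'rV[R]_m).

(** The closure of [T] is compact and covered by the open balls centred at points of [T]; the
    centres of a finite subcover form the net. *)
Lemma bounded_finite_net T (e : R) : bounded_set T -> 0 < e ->
  exists2 D : seq 'rV[R]_m, (forall t, t \in D -> T t) &
    forall t, T t -> exists2 s, s \in D & `|t - s| <= e.
Proof.
move=> bT e0.
have cT : compact (closure T).
  apply: bounded_closed_compact; last exact: closed_closure.
  case: bT => M [Mr TM]; exists M; split => // x Mx t.
  have cB : closed ((fun u : 'rV[R]_m => `|u|) @^-1` [set y | y <= x]).
    by apply: closed_comp; [move=> u _; exact: norm_continuous|exact: closed_le].
  have TB : T `<=` (fun u : 'rV[R]_m => `|u|) @^-1` [set y | y <= x].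
    by move=> u; exact: TM.
  by move=> /(closureS TB); rewrite -(closure_id _).1.
move: cT; rewrite compact_cover => /(_ _ T (fun s => ball s e)) [].
- by move=> s _; exact: ball_open.
- move=> t /(_ (ball t e)) []; first exact: nbhsx_ballx.
  by move=> s [Ts ts]; exists s => //; exact: ball_sym.
move=> D DT cov; exists (finmap.enum_fset D).
  by move=> t tD; have := DT t tD; rewrite inE.
move=> t Tt; have [s sD ts] := cov t (subset_closure Tt).
exists s => //; move: ts; rewrite -ball_normE /= distrC; exact: ltW.
Qed.

Lemma convex_hull_segment T s t (l : R) : T s -> T t -> 0 <= l <= 1 ->
  convex_hull T (s + l *: (t - s)).
Proof.
move=> Ts Tt /andP[l0 l1] A [cA TA].
have -> : s + l *: (t - s) = l *: t + (1 - l) *: s.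
  by rewrite scalerBl scale1r scalerBr addrCA.
by have := cA t s (Itv01 l0 l1); rewrite !inE; apply; exact: TA.
Qed.

End bounded_sets.

(** * Uniform law and consistency *)

Section net_sequence.
Context (R : realType) (m : nat) (T : set 'rV[R]_m).

(** The nets of mesh [j.+1%:R^-1] are strung into one sequence, so that almost sure statements about
    all of them involve only countably many null sets. *)
Lemma bounded_net_sequence : T !=set0 -> bounded_set T ->
  exists2 u : nat -> 'rV[R]_m, (forall k, T (u k)) &
    forall e, 0 < e -> exists p : nat, forall t, T t ->
      exists2 k, (k < p)%N & `|t - u k| <= e.
Proof.
move=> [t0 Tt0] bT.
have H (j : nat) : exists D : seq 'rV[R]_m, (forall t, t \in D -> T t) /\
    forall t, T t -> exists2 s, s \in D & `|t - s| <= j.+1%:R^-1.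
  have [|D DT Dnet] := @bounded_finite_net R m T j.+1%:R^-1 bT; last by exists D.
  by rewrite invr_gt0.
have {H} [D DP] := choice H.
(* [k] codes the pair of a net and a position in it; invalid codes fall back on [t0], which stays in
   [T]. *)
pose u k := if unpickle k is Some (j, i) then nth t0 (D j) i else t0.
exists u => [k|e e0].
  rewrite /u; case: unpickle => // -[j i].
  have [iD|Di] := ltnP i (size (D j)); last by rewrite nth_default.
  by apply: (DP j).1; exact: mem_nth.
have [j je] : exists j : nat, j.+1%:R^-1 <= e.
  by exists (Num.truncn e^-1); rewrite invf_ple// ?posrE// ltW// truncnS_gt.
(* One more than the largest code of a point of the [j]-th net. *)
exists (\max_(i < size (D j)) pickle (j, val i)).+1 => t Tt.
have [s sD ts] := (DP j).2 t Tt.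
have sj : (index s (D j) < size (D j))%N by rewrite index_mem.
exists (pickle (j, index s (D j))).
  by rewrite ltnS (leq_bigmax (Ordinal sj)).
by rewrite /u pickleK nth_index// (le_trans ts).
Qed.

End net_sequence.

(** * Comparison of infima *)

Section infima.
Context (R : realType) (I : Type) (T : set I).
Implicit Types a b : I -> R.

(** Each infimum is at most the other plus [r]; finiteness of one then forces that of the other, so
    the difference is a real one. *)
Lemma ereal_inf_dist_le a b (r : R) :
  ereal_inf [set (b t)%:E | t in T] \is a fin_num ->
  (forall t, T t -> `|a t - b t| <= r) ->
  (`|ereal_inf [set (a t)%:E | t in T] - ereal_inf [set (b t)%:E | t in T]|
    <= r%:E)%E.
Proof.
move=> bfin abr.
have ab t : T t -> b t - r <= a t /\ a t <= b t + r.
  by move=> /abr; rewrite ler_norml => /andP[h1 h2]; split; lra.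
move: bfin; set x := ereal_inf [set (b t)%:E | t in T] => xfin.
have lo : (x - r%:E <= ereal_inf [set (a t)%:E | t in T])%E.
  apply/ereal_infP => _ [t Tt <-].
  apply: (@le_trans _ _ (b t - r)%:E); last by rewrite lee_fin (ab t Tt).1.
  by rewrite EFinB leeB// ereal_inf_lbound//; exists t.
have up : (ereal_inf [set (a t)%:E | t in T] <= x + r%:E)%E.
  rewrite -leeBlDr//; apply/ereal_infP => _ [t Tt <-].
  rewrite leeBlDr//; apply: (@le_trans _ _ (a t)%:E).
    by rewrite ereal_inf_lbound//; exists t.
  by rewrite -EFinD lee_fin (ab t Tt).2.
move: lo up; rewrite -(fineK xfin); case: (ereal_inf _) => [y| |] //=.
by rewrite -EFinB -EFinD !lee_fin ler_norml => h1 h2; apply/andP; split; lra.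
Qed.

Lemma ereal_inf_dense a (u : nat -> I) : (forall k, T (u k)) ->
  (forall t e, T t -> 0 < e -> exists k, a (u k) <= a t + e) ->
  ereal_inf [set (a t)%:E | t in T] = ereal_inf (range (fun k => (a (u k))%:E)).
Proof.
move=> Tu dense; apply/eqP; rewrite eq_le; apply/andP; split.
  by apply/ereal_infP => _ [k _ <-]; apply: ereal_inf_lbound; exists (u k).
apply/ereal_infP => _ [t Tt <-]; apply/lee_addgt0Pr => e e0.
have [k ke] := dense t e Tt e0.
apply: (@le_trans _ _ (a (u k))%:E); last by rewrite -EFinD lee_fin.
by apply: ereal_inf_lbound; exists k.
Qed.

End infima.

Section uniform_law.
Context (R : realType) (m : nat) (T : set 'rV[R]_m).
Hypotheses (T_neq0 : T !=set0) (T_bounded : bounded_set T).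
Context (P : probability R R) (Q : probability (sample_space R) R).
Hypothesis PQ : is_infinite_product P Q.
Variables (g : 'rV[R]_m -> R -> R) (G : R -> R).
Hypothesis int_g : forall t, T t -> P.-integrable [set: R] (EFin \o g t).
Hypothesis int_G : P.-integrable [set: R] (EFin \o G).
Hypothesis G_ge0 : forall x, 0 <= G x.
Hypothesis gG : forall s t x, T s -> T t -> `|g t x - g s x| <= G x * `|t - s|.

Lemma mean_lipschitz n w s t : T s -> T t ->
  `|mean (g t) n w - mean (g s) n w| <= mean G n w * `|t - s|.
Proof.
move=> Ts Tt; rewrite /mean -mulrBr normrM ger0_norm ?invr_ge0// -mulrA.
rewrite ler_wpM2l ?invr_ge0// -sumrB mulr_suml.
by apply: le_trans (ler_norm_sum _ _ _) _; apply: ler_sum => k _; exact: gG.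
Qed.

Lemma expectation_lipschitz s t : T s -> T t ->
  `|\int[P]_x g t x - \int[P]_x g s x| <= (\int[P]_x G x) * `|t - s|.
Proof.
move=> Ts Tt; rewrite -RintegralB//; [|exact: int_g|exact: int_g].
have iB : P.-integrable [set: R] (EFin \o (fun x => g t x - g s x)).
  exact: (integrableB measurableT (int_g Tt) (int_g Ts)).
apply: le_trans (le_normr_Rintegral measurableT iB) _.
rewrite -RintegralZr//; apply: le_Rintegral => //.
- exact: (integrable_abse iB).
- have := integrableZr measurableT `|t - s| int_G.
  by apply: eq_integrable => // x _ /=; rewrite EFinM.
- by move=> x _; exact: gG.
Qed.

(* A finite net reduces the uniform statement to finitely many strong laws,
   the one for [G] controlling what happens between the points of the net. *)
Lemma ae_uniform_mean : {ae Q, forall w, forall e, 0 < e ->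
  \forall n \near \oo, forall t, T t ->
    `|mean (g t) n w - \int[P]_x g t x| <= e}.
Proof.
have [u Tu unet] := bounded_net_sequence T_neq0 T_bounded.
have := ae_foralln (fun k => strong_law_of_large_numbers PQ (int_g (Tu k))).
apply: filterS2 (strong_law_of_large_numbers PQ int_G) => w cG cu e e0.
set EG := \int[P]_x G x in cG.
have EG0 : 0 <= EG by exact: Rintegral_ge0.
(* Off the net the means vary by at most [(EG + 1) * d] and the expectations by [EG * d], together
   [e / 2]; the net points account for the other half. *)
pose d := e / 2 / (2 * EG + 1).
have d0 : 0 < d by rewrite !divr_gt0//; lra.
have [p pnet] := unet d d0.
have dE : d * (2 * EG + 1) = e / 2 by rewrite /d divfK// gt_eqF//; lra.
have cnet : \forall n \near \oo, forall k : 'I_p,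
    `|mean (g (u k)) n w - \int[P]_x g (u k) x| <= e / 2.
  apply: filter_forall => k.
  by have /cvgrPdistC_le/(_ (e / 2)) := cu k; apply; rewrite divr_gt0.
have cG1 : \forall n \near \oo, mean G n w <= EG + 1.
  by have /cvgr_le := cG; apply; rewrite ltrDl.
near=> n.
have cnetn : forall k : 'I_p,
    `|mean (g (u k)) n w - \int[P]_x g (u k) x| <= e / 2 by near: n.
have h2 : mean G n w <= EG + 1 by near: n.
move=> t Tt; have [k kp tk] := pnet t Tt.
have h1 := cnetn (Ordinal kp); rewrite /= in h1.
have h3 : `|mean (g t) n w - mean (g (u k)) n w| <= (EG + 1) * d.
  apply: le_trans (mean_lipschitz n w (Tu k) Tt) _.
  by apply: ler_pM => //; rewrite mulr_ge0 ?invr_ge0// sumr_ge0.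
have h4 : `|\int[P]_x g t x - \int[P]_x g (u k) x| <= EG * d.
  by apply: le_trans (expectation_lipschitz (Tu k) Tt) _; rewrite ler_wpM2l.
move: h1 h3 h4; rewrite !ler_norml => /andP[? ?] /andP[? ?] /andP[? ?].
by apply/andP; split; nra.
Unshelve. all: by end_near.
Qed.

End uniform_law.

(** * Measurability of the estimator *)

Section measurable_estimator.
Context (R : realType) (m : nat) (T : set 'rV[R]_m).
Hypotheses (T_neq0 : T !=set0) (T_bounded : bounded_set T).
Variables (g : 'rV[R]_m -> R -> R) (G : R -> R).
Hypothesis mg : forall t, T t -> measurable_fun [set: R] (g t).
Hypothesis G_ge0 : forall x, 0 <= G x.
Hypothesis gG : forall s t x, T s -> T t -> `|g t x - g s x| <= G x * `|t - s|.

Lemma measurable_mean (h : R -> R) n :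
  measurable_fun [set: R] h -> measurable_fun [set: sample_space R] (mean h n).
Proof.
move=> mh; apply: measurable_funM; first exact: measurable_cst.
apply: measurable_sum => k; apply: measurableT_comp => //.
exact: (@measurable_proj R k).
Qed.

Lemma measurable_estimator n :
  measurable_fun [set: sample_space R] (estimator T g n).
Proof.
have [u Tu unet] := bounded_net_sequence T_neq0 T_bounded.
rewrite (_ : estimator T g n =
    fun w => einfs (fun k => (mean (g (u k)) n w)%:E) 0%N); last first.
  apply/funext => w.
  rewrite /estimator (@ereal_inf_dense _ _ T (fun t => mean (g t) n w) u Tu).
    by congr ereal_inf; apply/seteqP; split => [_ [k _ <-]|_ [k _ <-]]; exists k.
  (* The mesh may depend on [w], since density is needed only pointwise; the added 1 keeps the
     denominator positive. *)
  move=> t e Tt e0; have [|p pnet] := unet (e / (mean G n w + 1)).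
    by rewrite divr_gt0// ltr_wpDl// mulr_ge0 ?invr_ge0// sumr_ge0.
  have [k _ tk] := pnet t Tt; exists k.
  have MG0 : 0 <= mean G n w by rewrite mulr_ge0 ?invr_ge0// sumr_ge0.
  have := mean_lipschitz gG n w (Tu k) Tt.
  move: tk; rewrite ler_pdivlMr ?ltr_wpDl// => h1.
  by have := normr_ge0 (t - u k); rewrite ler_norml => ? /andP[? _]; nra.
apply: measurable_fun_einfs => k; apply/measurable_EFinP.
by apply: measurable_mean; exact: mg.
Qed.

End measurable_estimator.

Section consistency.
Context d (W : measurableType d) (R : realType) (Q : probability W R).
Local Open Scope ereal_scope.

Lemma measurable_cover_id (h : W -> \bar R) :
  measurable_fun [set: W] h -> minimal_measurable_cover Q h h.
Proof. by move=> mh; split=> // g _ hg; exact: aeW. Qed.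

Lemma cvge0_le (u : nat -> \bar R) : (forall n, 0 <= u n) ->
  (forall e : R, (0 < e)%R -> \forall n \near \oo, u n <= e%:E) ->
  u n @[n --> \oo] --> 0.
Proof.
move=> u0 ule; apply/fine_cvgP; split.
  apply: filterS (ule 1%R ltr01) => n un.
  by rewrite ge0_fin_numE// (le_lt_trans un)// ltry.
apply/cvgr0Pnorm_le => e e0; apply: filterS (ule e e0) => n un.
have ufin : u n \is a fin_num by rewrite ge0_fin_numE// (le_lt_trans un)// ltry.
by rewrite /= ger0_norm ?fine_ge0// -lee_fin fineK.
Qed.

End consistency.

Theorem theorem13 (R : realType) (m : nat) (m_gt0 : (0 < m)%N)
    (N : 'rV[R]_m -> R) (normN : is_norm N)
    (T : set 'rV[R]_m) (T_neq0 : T !=set0) (T_bounded : bounded_set T)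
    (Pt : 'rV[R]_m -> probability R R)
    (P : probability R R)
    (Pinf : probability (sample_space R) R)
    (Pinf_product : is_infinite_product P Pinf)
    (f : R -> R)
    (mf : measurable_fun [set: R] f)
    (f_bounded :
       (ereal_sup [set 'E_(Pt t)[(fun x => `|f x|%R)] | t in T] < +oo)%E)
    (ft : 'rV[R]_m -> R -> R)
    (mft : forall t, T t -> measurable_fun [set: R] (ft t))
    (ft_mean : forall t, T t -> ('E_P[ft t] = 'E_(Pt t)[f])%E)
    (ft_abs_mean : forall t, T t ->
       ('E_P[(fun x => `|ft t x|%R)] = 'E_(Pt t)[(fun x => `|f x|%R)])%E)
    (Tc : set 'rV[R]_m) (Tc_open : open Tc) (Tc_hull : convex_hull T `<=` Tc)
    (fTc : R * 'rV[R]_m -> R)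
    (mfTc : measurable_fun
       ([set: R] `*` Tc : set (g_sigma_algebraType (@open (R * 'rV[R]_m)%type)))
       fTc)
    (ft_fTc : forall t, T t -> forall x, ft t x = fTc (x, t))
    (fTc_differentiable : forall x t, Tc t ->
       differentiable (fun s : 'rV[R]_m => fTc (x, s)) t)
    (F : R -> R)
    (mF : measurable_fun [set: R] F)
    (gradient_le : forall x t, Tc t ->
       N (gradient (fun s => fTc (x, s)) t) <= F x)
    (F_integrable : ('E_P[(fun x => `|F x|%R)] < +oo)%E) :
  strongly_consistent Pinf (estimator T ft) (lower_expectation T Pt f).
Proof.
have T_Tc t : T t -> Tc t by move=> Tt; apply: Tc_hull => A [_]; exact.
have [C C0 NC] := norm_le_is_norm normN.
have [t0 Tt0] := T_neq0.
(* [F] dominates a norm at the point [t0] of [T]. *)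
have F0 x : 0 <= F x.
  by apply: le_trans (is_norm_ge0 normN _) (gradient_le x t0 (T_Tc t0 Tt0)).
(* [m] comes from the mean value inequality and [C] from the comparison of norms. *)
pose G x := m%:R * (C * F x).
have G0 x : 0 <= G x by rewrite !mulr_ge0.
have ftG s t x : T s -> T t -> `|ft t x - ft s x| <= G x * `|t - s|.
  move=> Ts Tt; rewrite !ft_fTc//.
  apply: (@mean_value_le _ _ (fun s => fTc (x, s))) => l l01.
    by apply: fTc_differentiable; apply: Tc_hull; exact: convex_hull_segment.
  apply: le_trans (NC _) _; rewrite ler_wpM2l//; apply: gradient_le.
  by apply: Tc_hull; exact: convex_hull_segment.
have iF : P.-integrable [set: R] (EFin \o F).
  apply/integrableP; split; first exact/measurable_EFinP.
  by move: F_integrable; rewrite unlock.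
have iG : P.-integrable [set: R] (EFin \o G).
  have := integrableZl measurableT (m%:R * C) iF.
  by apply: eq_integrable => // x _ /=; rewrite /G mulrA EFinM.
(* This uniform bound on the absolute moments gives both the integrability of every [ft t] and,
   below, a finite lower bound for the infimum. *)
pose S := ereal_sup [set ('E_(Pt t)[(fun x => `|f x|%R)])%E | t in T].
have absS t : T t -> (\int[P]_x `|(ft t x)%:E| <= S)%E.
  move=> Tt; have := ft_abs_mean t Tt; rewrite unlock => E.
  by apply: ereal_sup_ubound; exists t => //; rewrite unlock -E.
have ift t : T t -> P.-integrable [set: R] (EFin \o ft t).
  move=> Tt; apply/integrableP; split; first by apply/measurable_EFinP; exact: mft.
  exact: le_lt_trans (absS _ Tt) f_bounded.
pose b t := \int[P]_x ft t x.
have thetaE : lower_expectation T Pt f = ereal_inf [set (b t)%:E | t in T].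
  congr ereal_inf; apply: eq_imagel => t Tt.
  rewrite -ft_mean// unlock /b /Rintegral fineK//.
  exact: (integrable_fin_num measurableT (ift t Tt)).
have theta_fin : ereal_inf [set (b t)%:E | t in T] \is a fin_num.
  have S0 : (0 <= S)%E by apply: le_trans (absS _ Tt0); exact: integral_ge0.
  have Sfin : S \is a fin_num by rewrite ge0_fin_numE.
  rewrite fin_numElt; apply/andP; split.
    apply: (@lt_le_trans _ _ (- S)%E).
      by rewrite -(fineK Sfin) ltNyr.
    apply/ereal_infP => _ [t Tt <-].
    rewrite -[leRHS]oppeK leeN2; apply: le_trans _ (absS _ Tt).
    rewrite -EFinN; apply: (@le_trans _ _ (`|b t|)%:E).
      by rewrite lee_fin -normrN ler_norm.
    rewrite EFin_normr_Rintegral//; last exact: ift.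
    by apply: le_abse_integral => //; exact: measurable_int (ift t Tt).
  apply: (@le_lt_trans _ _ (b t0)%:E); last exact: ltry.
  by apply: ereal_inf_lbound; exists t0.
exists (fun n w => `|estimator T ft n w - lower_expectation T Pt f|%E).
  move=> n; apply: measurable_cover_id.
  apply: measurableT_comp => //; apply: emeasurable_funB => //.
  exact: (measurable_estimator T_neq0 T_bounded mft G0 ftG).
apply: filterS (ae_uniform_mean T_neq0 T_bounded Pinf_product ift iG G0 ftG).
move=> w unif; apply: cvge0_le => // e e0.
apply: filterS (unif e e0) => n un.
rewrite thetaE; exact: (ereal_inf_dist_le theta_fin un).
Qed.
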